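(* Let $k$ be a non-negative integer and let $R$ be either the standard or the PSD color change rule. Then there is a finite family $\mathcal G$ of graphs such that, for every graph $G$ with $|V(G)|\geq k$, one has $\operatorname{th}_R(G)\geq |V(G)|-k$ if and only if $G$ contains no member of $\mathcal G$ as an induced subgraph. (That is, the set of graphs $G$ with $\operatorname{th}_R(G)\geq |V(G)|-k$ and $|V(G)|\geq k$ is characterized by a finite family of forbidden induced subgraphs.)
   Context: All graphs are finite, simple and undirected. Vertices are blue or white. Standard color change rule: a blue vertex $u$ can force a white vertex $w$ to become blue if $w$ is the only white neighbor of $u$. PSD color change rule: if $B$ is the current set of blue vertices of $G$ and $W_1,\dots,W_m$ are the vertex sets of the connected components of $G-B$, a blue vertex $u$ can force a white vertex $w$ to become blue if, for some $i$, $w$ is the only white neighbor of $u$ in $G[B\cup W_i]$. Let $R$ be one of these rules. For $B\subseteq V(G)$ initially blue (all other vertices white), a chronological list of $R$ forces of $B$ is an ordered list of valid forces performed consecutively until no further force is possible; the set of forces in such a list is called a set of $R$ forces of $B$. For a set $\mathcal F$ of $R$ forces of $B$, let $\mathcal F^{(0)}=B$ and let $\mathcal F^{(s+1)}$ be the set of white vertices $w$ such that some $(u\to w)\in\mathcal F$ is a valid $R$ force when exactly $\bigcup_{i=0}^{s}\mathcal F^{(i)}$ is blue. Let $\operatorname{pt}_R(G;\mathcal F)$ be the least $s$ with $\bigcup_{i=0}^{s}\mathcal F^{(i)}=V(G)$ ($\infty$ if there is none), $\operatorname{pt}_R(G;B)=\min_{\mathcal F}\operatorname{pt}_R(G;\mathcal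 F)$ over all sets $\mathcal F$ of $R$ forces of $B$, and $\operatorname{th}_R(G)=\min_{B\subseteq V(G)}\big(|B|+\operatorname{pt}_R(G;B)\big)$. *)

(* Defs.v *)
From mathcomp Require Import all_boot all_order all_algebra.
From mathcomp Require Import boolp constructive_ereal.

Set Implicit Arguments.
Unset Strict Implicit.
Unset Printing Implicit Defensive.

Import Order.TTheory GRing.Theory Num.Theory.

Record sgraph := SGraph {
  vertex :> finType;
  adj : rel vertex;
  adj_sym : symmetric adj;
  adj_irrefl : irreflexive adj }.

Definition contains_induced (G H : sgraph) : Prop :=
  exists2 f : H -> G, injective f & forall x y, adj (f x) (f y) = adj x y.

Inductive color_rule := Standard | PSD.

Section Forcing.

Variable G : sgraph.
Implicit Types (B S U W : {set G}) (u w : G) (F : {set G * G}).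

Definition adj_off B : rel G :=
  [rel x y | [&& x \notin B, y \notin B & adj x y]].

Definition components_off B : {set {set G}} :=
  equivalence_partition (connect (adj_off B)) (~: B).

(* White neighbors of u in G[S], when exactly B is blue. *)
Definition white_nbrs B S u : {set G} :=
  [set x in S | adj u x && (x \notin B)].

Definition can_force (R : color_rule) B u w : bool :=
  (u \in B) &&
  match R with
  | Standard => white_nbrs B setT u == [set w]
  | PSD => [exists W in components_off B, white_nbrs B (B :|: W) u == [set w]]
  end.

(* The pair (u, w) is the force u -> w. *)
Fixpoint chron_list (R : color_rule) B (s : seq (G * G)) : bool :=
  match s with
  | [::] => [forall u, forall w, ~~ can_force R B u w]
  | (u, w) :: s' => can_force R B u w && chron_list R (w |: B) s'
  end.

Definition set_of_forces (R : color_rule) B F : Prop :=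
  exists2 s : seq (G * G), chron_list R B s & F = [set f in s].

Definition newly_blue (R : color_rule) F U : {set G} :=
  [set w | (w \notin U) && [exists u, ((u, w) \in F) && can_force R U u w]].

(* With F^(0) = B and F^(s+1) = newly_blue R F (F^(0) u ... u F^(s)), this is
   the union of the F^(i) for i <= s. *)
Fixpoint blue_upto (R : color_rule) B F (s : nat) : {set G} :=
  if s is s'.+1 then
    blue_upto R B F s' :|: newly_blue R F (blue_upto R B F s')
  else B.

Local Open Scope ring_scope.
Local Open Scope ereal_scope.

Definition pt_forces (R : color_rule) B F : \bar int :=
  if pselect (exists s, blue_upto R B F s == setT) is left ex
  then (ex_minn ex)%:Z%:E else +oo.

Definition pt (R : color_rule) B : \bar int :=
  \big[mine/+oo]_(F : {set G * G} | `[< set_of_forces R B F >])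
     pt_forces R B F.

Definition th (R : color_rule) : \bar int :=
  \big[mine/+oo]_(B : {set G}) ((#|B|%:Z)%:E + pt R B).

End Forcing.

(* Main.v *)
Require Import Defs.
From mathcomp Require Import all_boot all_order all_algebra.
From mathcomp Require Import boolp constructive_ereal.
From mathcomp Require Import zify.

(** th(G) < |V| - k says that some forcing process satisfies [|S| - |D| > k],
    where [S] is the set of initially white vertices and [D] contains one
    vertex forced at each step. Turning any vertex of [S] blue from the start,
    or deleting blue vertices, preserves the validity of the remaining forces.
    So it suffices to keep [k+1] vertices of [S \ D], the representatives of
    their steps, and one forcing vertex for each of these: at most [4k+4]
    vertices. Hence the minimal graphs with th(G) < |V| - k have bounded order;
    conversely the property passes from an induced subgraph to the whole graph
    by colouring the other vertices blue. *)

Set Implicit Arguments.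
Unset Strict Implicit.
Unset Printing Implicit Defensive.

Import Order.TTheory GRing.Theory Num.Theory.

(** * One representative per value of a function *)

Section Transversal.

Variables (T : finType) (I : eqType) (S : {set T}) (f : T -> I).

Lemma exists_transversal : exists D : {set T},
  [/\ D \subset S, {in D &, injective f} &
      forall x, x \in S -> exists2 r, r \in D & f r = f x].
Proof.
(* [pick] returns the same element for all points of a fibre of [f] in [S]; these chosen elements
   form [D]. *)
exists [set x in S | [pick y in S | f y == f x] == Some x]; split.
- by apply/subsetP=> x; rewrite inE => /andP[].
- move=> x y; rewrite !inE => /andP[_ /eqP px] /andP[_ /eqP py] fxy.
  by apply: Some_inj; rewrite -px -py fxy.
move=> x xS; case E : [pick y in S | f y == f x] => [r|]; last first.
  by move: E; case: pickP => // /(_ x); rewrite xS eqxx.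
exists r.
  have [rS fr] : r \in S /\ f r = f x.
    by move: E; case: pickP => // z /andP[zS /eqP fz] [<-].
  by rewrite inE rS /= fr E.
by move: E; case: pickP => // z /andP[zS /eqP fz] [<-].
Qed.

End Transversal.

(** * Forces: monotonicity and transfer along induced embeddings *)

Section Forces.

Variable R : color_rule.

(** For white [w] and [x] under PSD: both lie in one component of the graph minus [B]. Always true
    under the standard rule, so that both rules share one description of a force. *)
Definition linked (G : sgraph) (B : {set G}) : rel G :=
  if R is PSD then connect (adj_off B) else fun _ _ => true.

Lemma can_forceP (G : sgraph) (B : {set G}) (u w : G) :
  reflect [/\ u \in B, w \notin B, adj u w &
              forall x, x \notin B -> adj u x -> linked B w x -> x = w]
          (can_force R B u w).
Proof.
rewrite /can_force /linked; case: R.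
  apply: (iffP andP) => [[uB /eqP/setP e]|[uB wB uw h]].
    have := e w; rewrite !inE eqxx => /and3P[_ uw wB]; split=> // x xB ux _.
    by apply/set1P; rewrite -e !inE ux xB.
  split=> //; apply/eqP/setP => x; rewrite !inE /=.
  by apply/andP/eqP => [[ux xB]|->]; [exact: h|split].
apply: (iffP andP) => [[uB /existsP[W /andP[/imsetP[v vB Wv] /eqP/setP e]]]|].
  have := e w; rewrite !inE eqxx => /and3P[wBW uw wB].
  have wW : w \in W by rewrite (negPf wB) in wBW.
  split=> // x xB ux wx; apply/set1P; rewrite -e !inE ux xB andbT.
  move: wW; rewrite Wv !inE xB => /andP[_ vw].
  by rewrite (connect_trans vw wx) orbT.
move=> [uB wB uw h]; split=> //; apply/existsP.
exists [set y in ~: B | connect (adj_off B) w y]; apply/andP; split.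
  by apply/imsetP; exists w; rewrite ?inE.
apply/eqP/setP => x; rewrite !inE.
apply/idP/eqP => [/and3P[xB' ux xB]|->]; last by rewrite wB uw connect0 orbT.
by apply: h => //; move: xB'; rewrite (negPf xB).
Qed.

Lemma linked_mono (G : sgraph) (B B' : {set G}) (w x : G) :
  B \subset B' -> linked B' w x -> linked B w x.
Proof.
rewrite /linked => /subsetP sBB'; case: R => //.
apply: connect_sub => y z /and3P[yB zB yz]; apply: connect1.
by apply/and3P; split=> //; [apply: contra yB|apply: contra zB]; apply: sBB'.
Qed.

(** More blue vertices leave fewer white neighbours of [u] and smaller components, so a white [w]
    remains the only candidate. *)
Lemma can_force_mono (G : sgraph) (B B' : {set G}) (u w : G) :
  B \subset B' -> w \notin B' -> can_force R B u w -> can_force R B' u w.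
Proof.
move=> sBB' wB' /can_forceP[uB wB uw h]; apply/can_forceP; split=> //.
  exact: (subsetP sBB').
move=> x xB' ux wx; apply: h => //; last exact: linked_mono wx.
by apply: contra xB'; apply: (subsetP sBB').
Qed.

Lemma linked_map (H G : sgraph) (f : H -> G) (B : {set H}) (B' : {set G}) w x :
  (forall y z, adj (f y) (f z) = adj y z) ->
  (forall y, (f y \in B') = (y \in B)) ->
  linked B w x -> linked B' (f w) (f x).
Proof.
move=> fadj fB; rewrite /linked; case: R => //= /connectP[p].
elim: p w => [|y p IH] w /=; first by move=> _ ->.
move=> /andP[/and3P[wB yB wy] yp] xp.
apply: connect_trans (IH y yp xp); apply: connect1.
by rewrite /adj_off /= !fB wB yB fadj wy.
Qed.

(** All white vertices of [G] lie in the image of [f], so a white path lifts vertex by vertex. *)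
Lemma linked_map_inv (H G : sgraph) (f : H -> G) (B : {set H}) (B' : {set G})
    w y :
  (forall y z, adj (f y) (f z) = adj y z) ->
  (forall y, (f y \in B') = (y \in B)) ->
  (forall y, y \notin B' -> exists z, y = f z) ->
  linked B' (f w) y -> forall x, y = f x -> injective f -> linked B w x.
Proof.
move=> fadj fB fW; rewrite /linked; case: R => //= /connectP[p].
elim: p w => [|z p IH] w /=; first by move=> _ -> x /[swap] fi /fi ->.
move=> /andP[/and3P[wB zB wz] zp] xp x yx fi.
have [z' ez] := fW _ zB; subst z.
apply: connect_trans (IH z' zp xp x yx fi); apply: connect1.
by rewrite /adj_off /= -!fB wB zB -fadj wz.
Qed.

Lemma can_force_restrict (H G : sgraph) (f : H -> G) (B : {set G}) u w :
  injective f -> (forall y z, adj (f y) (f z) = adj y z) ->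
  can_force R B (f u) (f w) -> can_force R (f @^-1: B) u w.
Proof.
move=> fi fadj /can_forceP[uB wB uw h]; apply/can_forceP; rewrite !inE.
split=> //; first by rewrite -fadj.
move=> x; rewrite inE => xB ux wx; apply: fi; apply: h; rewrite ?fadj //.
by apply: linked_map wx => // y; rewrite inE.
Qed.

(** The vertices outside the image are blue, so the white parts of the two graphs correspond under
    [f]. *)
Lemma can_force_extend (H G : sgraph) (f : H -> G) (B : {set H}) u w :
  injective f -> (forall y z, adj (f y) (f z) = adj y z) ->
  can_force R B u w -> can_force R (~: (f @: (~: B))) (f u) (f w).
Proof.
move=> fi fadj /can_forceP[uB wB uw h].
have fB y : (f y \in ~: (f @: (~: B))) = (y \in B).
  by rewrite inE (mem_imset _ _ fi) inE negbK.
have fW y : y \notin ~: (f @: (~: B)) -> exists z, y = f z.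
  by rewrite inE negbK => /imsetP[z _ ->]; exists z.
apply/can_forceP; split; rewrite ?fB ?fadj // => x xB.
have [z ez] := fW _ xB; subst x; rewrite fadj => uz wz; congr (f _).
by apply: h; rewrite -?fB //; apply: linked_map_inv wz _ _ _.
Qed.

End Forces.

(** * Timed forces, throttling and the reduction to few vertices *)

Section Schedules.

Variable R : color_rule.

(** [S] is the initially white set and [u w] forces [w] at time [t w], when the vertices of [S] with
    the same or a later time are still white. *)
Definition schedule (G : sgraph) (S : {set G}) (t : G -> nat) (u : G -> G) :=
  forall w, w \in S -> can_force R (~: [set x in S | t w <= t x]) (u w) w.

(* [t] need not take consecutive values: only the order of the times matters,
   and [#|D|] bounds the number of steps. *)
Definition saves (G : sgraph) (k : nat) := exists S t u (D : {set G}),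
  [/\ schedule S t u, D \subset S,
      forall w, w \in S -> exists2 r, r \in D & t r = t w & k + #|D| < #|S|].

Lemma schedule_sub (G : sgraph) (S S' : {set G}) t u :
  S' \subset S -> schedule S t u -> schedule S' t u.
Proof.
move=> sS h w wS'; apply: can_force_mono (h w (subsetP sS w wS')).
  rewrite setCS; apply/subsetP => x; rewrite !inE => /andP[xS' ->].
  by rewrite (subsetP sS).
by rewrite !inE wS' leqnn.
Qed.

Lemma blue_upto_mono (G : sgraph) (B : {set G}) F i j :
  i <= j -> blue_upto R B F i \subset blue_upto R B F j.
Proof.
move=> /subnK <-; elim: (j - i) => [|n IH] //=.
exact: subset_trans IH (subsetUl _ _).
Qed.

(** A vertex of least time can be forced first, and dropping it from [S] leaves a schedule. The list
    is complete because it ends with every vertex blue. *)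
Lemma schedule_chron_list (G : sgraph) (S : {set G}) t u : schedule S t u ->
  exists2 s, chron_list R (~: S) s & [set f in s] = [set (u w, w) | w in S].
Proof.
have [n] := ubnP #|S|; elim: n S => // n IH S Sn h.
have [S0|[w0 w0S]] := set_0Vmem S.
  exists [::]; last by rewrite S0 imset0; apply/setP => x; rewrite !inE.
  apply/forallP => a; apply/forallP => b; apply/negP => /can_forceP[_].
  by rewrite S0 !inE.
have [w wS wmin] := @arg_minnP G w0 [in S] t w0S.
have [||s sch sE] := IH (S :\ w).
- by move: Sn; rewrite (cardsD1 w S) wS.
- exact: schedule_sub (subsetDl _ _) h.
exists ((u w, w) :: s).
  rewrite /=; apply/andP; split.
    apply: can_force_mono (h w wS); last by rewrite inE negbK.
    by rewrite setCS; apply/subsetP => x xS; rewrite inE xS wmin.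
  by rewrite setCD setUC in sch.
by rewrite set_cons sE -[in RHS](setD1K wS) imsetU1.
Qed.

(** As [D] meets every time that occurs, there are at most [#|D|] distinct times, and one round is
    enough for each. *)
Lemma schedule_blue_upto (G : sgraph) (S : {set G}) t u (D : {set G}) :
  schedule S t u -> (forall w, w \in S -> exists2 r, r \in D & t r = t w) ->
  blue_upto R (~: S) [set (u w, w) | w in S] #|D| = setT.
Proof.
(* [lev] renumbers the times of [t] consecutively from 1. *)
move=> h hD; pose lev w := #|[set r in D | t r <= t w]|.
have key s w : w \in S -> lev w <= s ->
    w \in blue_upto R (~: S) [set (u w, w) | w in S] s.
  elim: s w => [|s IH] w wS /=.
    have [r rD tr] := hD w wS.
    by rewrite leqn0 cards_eq0 => /eqP/setP/(_ r); rewrite !inE rD tr leqnn.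
  move=> lw; rewrite inE; case: (boolP (w \in _)) => //= wU.
  rewrite inE wU /=; apply/existsP; exists (u w).
  rewrite imset_f //=; apply: can_force_mono (h w wS) => //.
  apply/subsetP => x; rewrite !inE negb_and => xS.
  case: (boolP (x \in S)) xS => [xS /= tx|xS _]; last first.
    by apply: (subsetP (blue_upto_mono _ _ (leq0n s))); rewrite inE.
  apply: IH => //; rewrite -ltnS; apply: leq_trans lw.
  (* The representative of [w] is counted in [lev w] but not in [lev x], since [t x < t w]. *)
  apply: proper_card; rewrite -ltnNge in tx; apply/properP; split.
    apply/subsetP => r; rewrite !inE => /andP[-> /= rx].
    exact: leq_trans rx (ltnW tx).
  have [r rD tr] := hD w wS; exists r; rewrite !inE rD tr ?leqnn //=.
  by rewrite -ltnNge.
apply/setP => w; rewrite inE; have [wS|wS] := boolP (w \in S).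
  by apply: key => //; apply: subset_leq_card; apply/subsetP => r /setIdP[].
by apply: (subsetP (blue_upto_mono _ _ (leq0n _))); rewrite inE.
Qed.

(** Take for [t w] the first round in which [w] is blue. Vertices blue before that round have
    smaller [t], so monotonicity keeps the force valid. *)
Lemma blue_upto_schedule (G : sgraph) (B : {set G}) F s :
  blue_upto R B F s = setT ->
  exists t u, schedule (~: B) t u /\
    forall w, w \in ~: B -> 0 < t w <= s.
Proof.
move=> Us.
have ex w : exists j, w \in blue_upto R B F j by exists s; rewrite Us inE.
pose t w := ex_minn (ex w).
have /choice[u uP] : forall w, exists v, w \in ~: B ->
    can_force R (~: [set x in ~: B | t w <= t x]) v w /\ 0 < t w <= s.
  move=> w; have [wB|wB] := boolP (w \in ~: B); last by exists w.
  have tws : t w <= s.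
    by rewrite /t; case: ex_minnP => j _; apply; rewrite Us inE.
  have [j tw] : exists j, t w = j.+1.
    rewrite /t; case: ex_minnP => -[|j] /=; last by exists j.
    by rewrite inE in wB; rewrite (negPf wB).
  have : w \in blue_upto R B F j.+1.
    by rewrite -tw /t; case: ex_minnP.
  have wj : w \notin blue_upto R B F j.
    by apply/negP => wj; have := leqnn (t w); rewrite {1}tw /t;
      case: ex_minnP => i _ /(_ j wj) ij; rewrite ltnNge ij.
  rewrite /= inE (negPf wj) inE wj /= => /existsP[v /andP[_ vw]].
  exists v => _; split; last by rewrite tws tw.
  apply: can_force_mono vw; last by rewrite inE negbK inE wB leqnn.
  apply/subsetP => x xj; rewrite !inE negb_and -ltnNge; apply/orP; right.
  by rewrite tw ltnS /t; case: ex_minnP => i _; apply.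
by exists t, u; split=> w /uP[].
Qed.

(** Sets of forces that never colour everything have propagation time [+oo] and so satisfy any lower
    bound. *)
Lemma th_geP (G : sgraph) (z : int) :
  reflect (forall (B : {set G}) F s, set_of_forces R B F ->
             blue_upto R B F s = setT -> (z <= #|B|%:Z + s%:Z)%R)
          ((z%:E)%E <= th G R)%E.
Proof.
have fin (n : nat) : (n%:Z%:E)%E \is a fin_num by [].
apply: (iffP idP) => [/bigmin_geP[_ h] B F s BF Us|h].
  have := h B isT; rewrite addeC -leeBlDr // => /bigmin_geP[_ /(_ F)].
  rewrite asboolT // => /(_ isT); rewrite leeBlDr // /pt_forces.
  case: pselect => [ex|]; last by case; exists s; rewrite Us.
  case: ex_minnP => m _ /(_ s); rewrite Us eqxx => /(_ isT) ms.
  rewrite -EFinD lee_fin => /le_trans; apply.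
  by rewrite addrC lerD2l lez_nat.
apply/bigmin_geP; split=> [|B _]; first exact: leey.
rewrite addeC -leeBlDr //; apply/bigmin_geP; split=> [|F /asboolP BF].
  exact: leey.
rewrite leeBlDr // /pt_forces; case: pselect => [ex|_].
  case: ex_minnP => m /eqP Um _; rewrite -EFinD lee_fin addrC.
  exact: h Um.
by rewrite addye // leey.
Qed.

Lemma th_ge_saves (G : sgraph) (k : nat) :
  (((#|G|%:Z - k%:Z)%R%:E <= th G R)%E <-> ~ saves G k).
Proof.
split=> [/th_geP h [S [t [u [D [sch DS hD lt]]]]]|nsaves].
  have [l lch lE] := schedule_chron_list sch.
  have := h _ _ _ _ (schedule_blue_upto sch hD).
  have SF : set_of_forces R (~: S) [set (u w, w) | w in S] by exists l.
  move=> /(_ SF); rewrite lerBlDr -!PoszD lez_nat -(cardsC S); lia.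
apply/th_geP => B F s _ Us; rewrite leNgt; apply/negP => lt; apply: nsaves.
have [t [u [sch ts]]] := blue_upto_schedule Us.
have [D [DB tD hD]] := exists_transversal (~: B) t.
exists (~: B), t, u, D; split=> //.
have : #|D| <= s.
  have Dt w : w \in D -> 0 < t w <= s by move=> /(subsetP DB)/ts.
  have ti : {in D &, injective (fun w => inord (t w) : 'I_s.+1)}.
    move=> x y xD yD /(congr1 val) /=.
    have /andP[_ xs] := Dt _ xD; have /andP[_ ys] := Dt _ yD.
    by rewrite !inordK //; apply: tD.
  (* Times lie between 1 and [s]; omitting [ord0] leaves exactly [s] values. *)
  have cs : #|[set~ ord0 : 'I_s.+1]| = s by rewrite cardsC1 card_ord.
  rewrite -(card_in_imset ti) -[X in _ <= X]cs.
  apply: subset_leq_card; apply/subsetP => _ /imsetP[w wD ->].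
  have /andP[w0 ws] := Dt _ wD; rewrite !inE -val_eqE /= inordK //.
  by rewrite -lt0n.
move: lt; rewrite ltrBrDr -!PoszD ltz_nat -(cardsC B); lia.
Qed.

Lemma saves_induced (G H : sgraph) (k : nat) :
  contains_induced G H -> saves H k -> saves G k.
Proof.
move=> [f fi fadj] [S [t [u [D [sch DS hD lt]]]]].
(* The partial inverse [g] carries [t] and [u] to [G]; arbitrary defaults fill in the vertices
   outside the image, which are blue from the start. *)
have [g gK] : exists g : G -> option H, forall x, g (f x) = Some x.
  exists (fun y => [pick x | f x == y]) => x.
  by case: pickP => [z /eqP/fi ->|/(_ x)]; rewrite ?eqxx.
exists (f @: S), (fun y => oapp t 0 (g y)).
exists (fun y => oapp (f \o u) y (g y)), (f @: D); split.
- move=> _ /imsetP[w wS ->]; rewrite !gK /=.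
  have := can_force_extend fi fadj (sch w wS).
  congr (can_force _ _ _ _); congr (~: _); apply/setP => y.
  rewrite setCK inE; apply/imsetP/andP.
    move=> [x]; rewrite inE => /andP[xS wx] ->.
    by rewrite imset_f // gK.
  move=> [/imsetP[x xS ->]]; rewrite gK /= => wx.
  by exists x; rewrite // inE xS.
- exact: imsetS.
- move=> _ /imsetP[w wS ->]; have [r rD tr] := hD w wS.
  by exists (f r); rewrite ?imset_f // !gK.
by rewrite !card_imset.
Qed.

(** The image of [f] contains [S] and all forcing vertices, so the schedule pulls back and [S] and
    [D] keep their cardinalities. *)
Lemma saves_restrict (G H : sgraph) (k : nat) (f : H -> G) S t u
    (D : {set G}) :
  injective f -> (forall x y, adj (f x) (f y) = adj x y) ->
  schedule S t u -> D \subset S ->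
  (forall w, w \in S -> exists2 r, r \in D & t r = t w) -> k + #|D| < #|S| ->
  (forall w, w \in S -> exists x, f x = w) ->
  (forall w, w \in S -> exists x, f x = u w) ->
  saves H k.
Proof.
move=> fi fadj sch DS hD lt fS fu.
have cardf (A : {set G}) : A \subset S -> #|f @^-1: A| = #|A|.
  move=> /subsetP AS; rewrite -(card_imset _ fi); congr #|pred_of_set _|.
  apply/setP => y; apply/imsetP/idP => [[x]|yA]; first by rewrite inE => xA ->.
  by have [x xy] := fS y (AS y yA); exists x; rewrite // inE xy.
have /choice[v vP] : forall x, exists y, f x \in S -> f y = u (f x).
  move=> x; have [xS|xS] := boolP (f x \in S); last by exists x.
  by have [y yx] := fu _ xS; exists y.
exists (f @^-1: S), (t \o f), v, (f @^-1: D); split.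
- move=> w; rewrite inE => wS; have := sch _ wS; rewrite -vP //.
  move=> /(can_force_restrict fi fadj); congr (can_force _ _ _ _).
  by apply/setP => x; rewrite !inE.
- exact: preimsetS.
- move=> w; rewrite inE => /hD[r rD tr].
  have [x xr] := fS _ (subsetP DS r rD).
  by exists x; rewrite ?inE /= xr.
by rewrite !cardf.
Qed.

(** Keep a set [N] of [k.+1] vertices of [S] outside [D] and the representatives [r @: N] of their
    times in [D]. The two sets are disjoint, so the union exceeds [r @: N] by exactly [k.+1]. *)
Lemma saves_small (G : sgraph) (k : nat) : saves G k ->
  exists S t u (D : {set G}), [/\ schedule S t u, D \subset S,
    forall w, w \in S -> exists2 r, r \in D & t r = t w,
    k + #|D| < #|S| & #|S| <= 2 * k.+1].
Proof.
move=> [S [t [u [D [sch DS hD lt]]]]].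
have : k.+1 <= #|S :\: D|.
  by rewrite cardsD (setIidPr DS) ltn_subRL addnC.
move=> /card_geqP[l [luniq lsize lS]]; pose N := [set x in l].
have NS : N \subset S :\: D by apply/subsetP => x; rewrite inE => /lS.
have Nk : #|N| = k.+1 by rewrite cardsE (card_uniqP luniq).
have /choice[r rP] : forall w, exists r, w \in S -> r \in D /\ t r = t w.
  move=> w; have [wS|wS] := boolP (w \in S); last by exists w.
  by have [r rD tr] := hD w wS; exists r.
have NS' w : w \in N -> w \in S by move=> /(subsetP NS)/setDP[].
have rND : r @: N \subset D.
  by apply/subsetP => _ /imsetP[w /NS' wS ->]; case: (rP w wS).
have dis : [disjoint N & r @: N].
  rewrite disjoints_subset; apply/subsetP => w /(subsetP NS)/setDP[_ wD].
  by rewrite inE; apply: contra wD; apply: (subsetP rND).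
have cardU : #|N :|: r @: N| = k.+1 + #|r @: N|.
  by rewrite cardsU (disjoint_setI0 dis) cards0 subn0 Nk.
exists (N :|: r @: N), t, u, (r @: N); split.
- apply: schedule_sub sch; rewrite subUset (subset_trans rND DS) andbT.
  exact/subsetP.
- exact: subsetUr.
- move=> w /setUP[wN|wN]; last by exists w.
  by exists (r w); [rewrite imset_f|case: (rP w (NS' w wN))].
- by rewrite cardU addSn.
by rewrite cardU mul2n -addnn leq_add2l -Nk leq_imset_card.
Qed.

End Schedules.

(** * Finitely many codes for the graphs of bounded order *)

Section OrdGraph.

Variables (n : nat) (E : {set 'I_n * 'I_n}).

(** Symmetrizing [E] and removing loops lets every set of pairs encode a simple graph, so the codes
    form a finite type. *)
Definition ord_adj : rel 'I_n :=
  fun i j => (i != j) && (((i, j) \in E) || ((j, i) \in E)).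

Lemma ord_adj_sym : symmetric ord_adj.
Proof. by move=> i j; rewrite /ord_adj eq_sym orbC. Qed.

Lemma ord_adj_irrefl : irreflexive ord_adj.
Proof. by move=> i; rewrite /ord_adj eqxx. Qed.

Definition ord_graph := SGraph ord_adj_sym ord_adj_irrefl.

End OrdGraph.

Lemma exists_ord_graph (G : sgraph) (X : {set G}) :
  exists (E : {set 'I_#|X| * 'I_#|X|}) (f : ord_graph E -> G),
  [/\ injective f, forall x y, adj (f x) (f y) = adj x y &
      forall y, y \in X -> exists x, f x = y].
Proof.
pose f : 'I_#|X| -> G := enum_val.
exists [set p | adj (f p.1) (f p.2)], f; split.
- exact: enum_val_inj.
- move=> x y; rewrite [RHS]/= /ord_adj !inE /= [adj (f y) _]adj_sym orbb.
  by case: eqVneq => [->|]; rewrite ?adj_irrefl.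
by move=> y yX; exists (enum_rank_in yX y); rewrite /f enum_rankK_in.
Qed.

Lemma saves_small_induced (R : color_rule) (G : sgraph) (k : nat) :
  saves R G k -> exists (n : 'I_(4 * k.+1).+1) (E : {set 'I_n * 'I_n}),
    contains_induced G (ord_graph E) /\ saves R (ord_graph E) k.
Proof.
move=> /saves_small[S [t [u [D [sch DS hD lt Sk]]]]].
pose X := S :|: u @: S.
(* At most [2 * k.+1] vertices in [S], and at most one forcing vertex for each. *)
have Xk : #|X| < (4 * k.+1).+1.
  rewrite ltnS; apply: leq_trans (leq_card_setU _ _) _.
  apply: leq_trans (leq_add Sk (leq_trans (leq_imset_card u _) Sk)) _; lia.
have [E [f [fi fadj fX]]] := exists_ord_graph X.
exists (Ordinal Xk), E; split; first by exists f.
apply: (saves_restrict fi fadj sch DS hD lt) => w wS; apply: fX.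
  by rewrite inE wS.
by rewrite inE imset_f ?orbT.
Qed.

Theorem theorem4p7 (k : nat) (R : color_rule) :
  exists (m : nat) (family : 'I_m -> sgraph),
  forall G : sgraph, (k <= #|G|)%N ->
    (((#|G|%:Z - k%:Z)%R%:E <= th G R)%E <->
     ~ exists i : 'I_m, contains_induced G (family i)).
Proof.
pose T := {n : 'I_(4 * k.+1).+1 & {set 'I_n * 'I_n}}.
pose graph (p : T) := ord_graph (tagged p).
(* The family takes every coded graph of order at most [4 * k.+1] that satisfies [saves], not just
   the minimal ones. *)
pose A := [set p : T | `[< saves R (graph p) k >]].
exists #|A|, (fun i => graph (enum_val i)) => G _.
rewrite th_ge_saves; split=> nG.
  move=> [i Gi]; apply: nG; apply: saves_induced Gi _.
  by have := enum_valP i; rewrite inE => /asboolP.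
move=> /saves_small_induced[n [E [GE sE]]]; apply: nG.
pose p : T := existT _ n E.
have pA : p \in A by rewrite inE; apply/asboolP.
by exists (enum_rank_in pA p); rewrite enum_rankK_in.
Qed.
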